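(* Let $t \ge 3$ and $n \ge 3$ be integers. Then $M_t(C_n)$ is a distance magic graph if and only if $n = 4$.
   Context: $C_n$ is the cycle on $n$ vertices. For a graph $G=(V,E)$ and an integer $t \ge 1$, the generalised Mycielskian $M_t(G)$ is the graph with vertex set $(V \times \{0,1,\dots,t-1\}) \cup \{u\}$ (where $u$ is a new vertex), whose edges are: $(x,0)(y,0)$ for every edge $xy \in E$; $(x,i)(y,i+1)$ for every $0 \le i \le t-2$ and every ordered pair $(x,y)$ with $xy \in E$; and $(x,t-1)u$ for every $x \in V$. A graph $H$ on $N$ vertices is distance magic if there is a bijection $f: V(H) \to \{1,2,\dots,N\}$ and a constant $k$ such that for every vertex $v$, $\sum_{w \in N(v)} f(w) = k$, where $N(v)$ is the open neighbourhood of $v$. *)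

(* Defs.v *)
From mathcomp Require Import all_boot.

Set Implicit Arguments.
Unset Strict Implicit.
Unset Printing Implicit Defensive.

Record sgraph := SGraph {
  svertex :> finType;
  sedge : rel svertex;
  sedge_sym : symmetric sedge;
  sedge_irrefl : irreflexive sedge
}.

Definition open_nbhd (G : sgraph) (v : G) : {set G} := [set w | sedge v w].

(* ordS i is the cyclic successor of i in 'I_n. The conjunct i != j only
   matters for n = 1, where it removes the loop. *)
Definition cycle_edge (n : nat) (i j : 'I_n) : bool :=
  (i != j) && ((ordS i == j) || (ordS j == i)).

Lemma cycle_edge_sym (n : nat) : symmetric (@cycle_edge n).
Proof. by move=> i j; rewrite /cycle_edge eq_sym orbC. Qed.

Lemma cycle_edge_irrefl (n : nat) : irreflexive (@cycle_edge n).
Proof. by move=> i; rewrite /cycle_edge eqxx. Qed.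

Definition cycle_graph (n : nat) : sgraph :=
  SGraph (@cycle_edge_sym n) (@cycle_edge_irrefl n).

(* Some (x, i) is the copy of x at level i, and None is the new vertex u. *)
Definition mycielskian_edge (t : nat) (G : sgraph)
    (a b : option (G * 'I_t)) : bool :=
  match a, b with
  | Some (x, i), Some (y, j) =>
      sedge x y && [|| (i == 0 :> nat) && (j == 0 :> nat),
                       j == i.+1 :> nat | i == j.+1 :> nat]
  | Some (_, i), None | None, Some (_, i) => i == t.-1 :> nat
  | None, None => false
  end.

Lemma mycielskian_edge_sym (t : nat) (G : sgraph) :
  symmetric (@mycielskian_edge t G).
Proof.
move=> [[x i]|] [[y j]|] //=.
by rewrite sedge_sym andbC [X in _ || X]orbC andbC [(i == 0 :> nat) && _]andbC.
Qed.

Lemma mycielskian_edge_irrefl (t : nat) (G : sgraph) :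
  irreflexive (@mycielskian_edge t G).
Proof. by move=> [[x i]|] //=; rewrite sedge_irrefl. Qed.

Definition mycielskian (t : nat) (G : sgraph) : sgraph :=
  SGraph (@mycielskian_edge_sym t G) (@mycielskian_edge_irrefl t G).

Definition distance_magic (H : sgraph) : Prop :=
  exists (f : H -> nat) (k : nat),
    [/\ injective f,
        (forall m : nat, (m \in codom f) = (1 <= m <= #|H|))
      & forall v : H, \sum_(w in open_nbhd v) f w = k].

(* Main.v *)
Require Import Defs.
From mathcomp Require Import all_boot.
From mathcomp Require Import zify.

(** Write [a_i x] for the label of the copy of [x] at level [i]. The neighbours
    of [(x, t-1)] are [u] and the two vertices [(x-1, t-2)], [(x+1, t-2)], so
    [a_(t-2) (x-1) + a_(t-2) (x+1)] does not depend on [x]. Hence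
    [a_(t-2) x = a_(t-2) (x+4)], and injectivity of the labelling forces [n] to
    divide 4. Conversely, for [n = 4] give [u] the label [4t+1] and split
    [1, ..., 4t] into pairs with sum [4t+1], each pair being placed on two
    opposite vertices of one copy of the 4-cycle: every neighbourhood then
    consists of [u] and one such pair, or of two such pairs. *)

Lemma big_option (T : finType) (P : pred (option T)) (F : option T -> nat) :
  \sum_(w | P w) F w =
    (if P None then F None else 0) + \sum_(p | P (Some p)) F (Some p).
Proof.
rewrite big_mkcond (bigD1 None) //=; congr (_ + _).
rewrite (reindex_omap Some id) /=; last by case.
by rewrite [RHS]big_mkcond; apply: eq_bigl => p; rewrite eqxx.
Qed.

(** Needed so that a neighbourhood sum on the cycle has two separate terms; for [n = 2] the two
    vertices coincide. *)
Lemma ordS_ord_pred_neq (n : nat) (hn : 3 <= n) (x : 'I_n) :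
  ordS x != ord_pred x.
Proof.
apply/eqP => /(congr1 val) /=; have := ltn_ord x; move: (val x) => m hm.
case: m hm => [|m] hm /=.
  by rewrite add0n !modn_small; lia.
rewrite modnDr (modn_small (m := m)); last lia.
have [h|h] : m.+2 = n \/ m.+2 < n by lia.
  by rewrite h modnn; lia.
by rewrite modn_small; lia.
Qed.

Lemma ordS_neq (n : nat) (hn : 2 <= n) (x : 'I_n) : ordS x != x.
Proof.
apply/eqP => /(congr1 val) /=; have hx := ltn_ord x.
have [h|h] : x.+1 = n \/ x.+1 < n by lia.
  by rewrite h modnn; lia.
by rewrite modn_small; lia.
Qed.

Lemma sum_cycle_nbhd (n : nat) (hn : 3 <= n) (x : 'I_n) (g : 'I_n -> nat) :
  \sum_(y | cycle_edge x y) g y = g (ordS x) + g (ord_pred x).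
Proof.
have neq := ordS_ord_pred_neq n hn x.
have nS := ordS_neq n (ltnW hn) x.
have nP : ord_pred x != x.
  by apply/eqP => e; have := ordS_neq n (ltnW hn) (ord_pred x);
     rewrite ord_predK e eqxx.
rewrite (bigD1 (ordS x)) /=; last by rewrite /cycle_edge eq_sym nS eqxx.
congr (_ + _); rewrite (big_pred1 (ord_pred x)) // => y /=.
rewrite /cycle_edge.
have -> : (ordS y == x) = (y == ord_pred x).
  by rewrite -(inj_eq (@ord_pred_inj n)) ordSK.
have [->|ny] := eqVneq y (ord_pred x).
  by rewrite eq_sym nP orbT eq_sym neq.
by rewrite orbF -andbA [y == _]eq_sym andbN andbF.
Qed.

(** The path on the levels with a loop at level 0. Without [u], the Mycielskian is the direct
    product of the graph with this looped path. *)
Definition level_adj (i j : nat) : bool :=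
  [|| (i == 0) && (j == 0), j == i.+1 | i == j.+1].

Lemma sum_mycielskian_nbhd (t n : nat) (hn : 3 <= n)
    (f : mycielskian t (cycle_graph n) -> nat) (x : 'I_n) (i : 'I_t) :
  \sum_(w in open_nbhd (G := mycielskian t (cycle_graph n)) (Some (x, i))) f w =
  (if i == t.-1 :> nat then f None else 0) +
  \sum_(j < t | level_adj i j)
    (f (Some (ordS x, j)) + f (Some (ord_pred x, j))).
Proof.
rewrite [LHS](eq_bigl (mycielskian_edge (G := cycle_graph n) (Some (x, i))));
  last by move=> w; rewrite inE.
rewrite big_option /=; congr (_ + _).
under [RHS]eq_bigr => j _.
  rewrite -(sum_cycle_nbhd n hn x (fun y => f (Some (y, j)))).
over.
rewrite exchange_big pair_big_dep /=.
by apply: eq_big => [[y j]|[y j] _].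
Qed.

Lemma ordS4 (n : nat) (x : 'I_n) :
  val (ordS (ordS (ordS (ordS x)))) = (x + 4) %% n.
Proof.
have SE m : (m %% n).+1 = m.+1 %[mod n] by rewrite -addn1 modnDml addn1.
by rewrite /= (SE x.+1) (SE x.+2) (SE x.+3) addn4.
Qed.

Lemma distance_magic_mycielskian_cycle_eq4 (t n : nat) :
  2 <= t -> 3 <= n ->
  distance_magic (mycielskian t (cycle_graph n)) -> n = 4.
Proof.
move=> ht hn [f [k [f_inj _ f_sum]]].
have h1 : t.-1 < t by lia.
have h2 : t.-2 < t by lia.
pose a (x : 'I_n) := f (Some (x, Ordinal h2)).
have aE (x : 'I_n) : f None + (a (ordS x) + a (ord_pred x)) = k.
  rewrite -(f_sum (Some (x, Ordinal h1))) sum_mycielskian_nbhd // eqxx.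
  (* Since [t >= 2], the top level is not the looped level 0, so [t.-2] is its only adjacent
     level. *)
  congr (_ + _); rewrite (big_pred1 (Ordinal h2)) // => j.
  rewrite /level_adj /= -val_eqE /=.
  by have := ltn_ord j; lia.
have a4 (x : 'I_n) : a (ordS (ordS (ordS (ordS x)))) = a x.
  (* The equations at [x+1] and [x+3] share the term [a (x+2)]; cancelling it leaves
     [a x = a (x+4)]. *)
  have := aE (ordS x); have := aE (ordS (ordS (ordS x))).
  by rewrite !ordSK; lia.
have h0 : 0 < n by lia.
have [e] := f_inj _ _ (a4 (Ordinal h0)).
have n_dvd4 : n %| 4 by have := ordS4 n (Ordinal h0); rewrite /= e => /esym/eqP.
have := dvdn_leq (isT : 0 < 4) n_dvd4.
by case: n hn n_dvd4 {f f_inj f_sum a aE a4 h0 e} => [|[|[|[|[|]]]]].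
Qed.

(** Level [i] takes the small labels [2i+1], [2i+2] on vertices 0, 1 and their complements to [4t+1]
    on the opposite vertices 2, 3. Over all levels the small labels fill [1..2t] and the complements
    [2t+1..4t]. *)
Definition c4_label (t : nat) (v : mycielskian t (cycle_graph 4)) : nat :=
  if v is Some (x, i) then
    nth 0 [:: 2 * i + 1; 2 * i + 2; 4 * t - 2 * i; 4 * t - (2 * i + 1)] x
  else 4 * t + 1.

Lemma card_mycielskian_cycle (t n : nat) :
  #|mycielskian t (cycle_graph n)| = (n * t).+1.
Proof. by rewrite card_option card_prod !card_ord. Qed.

Lemma c4_label_inj (t : nat) : injective (@c4_label t).
Proof.
move=> [[x i]|] [[y j]|] //=.
- move: (ltn_ord x) (ltn_ord y) (ltn_ord i) (ltn_ord j) => hx hy hi hj e.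
  have [exy eij] : x = y :> nat /\ i = j :> nat.
    move: (nat_of_ord x) (nat_of_ord y) hx hy e => {x y}.
    by move=> [|[|[|[|?]]]] [|[|[|[|?]]]] //= _ _; lia.
  by congr (Some (_, _)); apply: val_inj.
- move: (ltn_ord x) (ltn_ord i); move: (nat_of_ord x).
  by move=> [|[|[|[|?]]]] //= _; lia.
move: (ltn_ord y) (ltn_ord j); move: (nat_of_ord y).
by move=> [|[|[|[|?]]]] //= _; lia.
Qed.

Lemma c4_label_bounds (t : nat) (v : mycielskian t (cycle_graph 4)) :
  1 <= c4_label t v <= 4 * t + 1.
Proof.
case: v => [[[x hx] i]|] /=; last lia.
by have := ltn_ord i; case: x hx => [|[|[|[|]]]] //= _; lia.
Qed.

(** Pigeonhole: [4t+1] distinct labels inside an interval of size [4t+1] exhaust it. *)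
Lemma c4_label_codom (t m : nat) :
  (m \in codom (@c4_label t)) = (1 <= m <= 4 * t + 1).
Proof.
have -> : (1 <= m <= 4 * t + 1) = (m \in iota 1 (4 * t + 1)).
  by rewrite mem_iota; lia.
have u : uniq (codom (@c4_label t)) by apply/injectiveP; apply: c4_label_inj.
have s : {subset codom (@c4_label t) <= iota 1 (4 * t + 1)}.
  by move=> _ /codomP[v ->]; rewrite mem_iota; have := c4_label_bounds t v; lia.
have [] := uniq_min_size u s; last by move=> _ ->.
by rewrite size_iota size_codom card_mycielskian_cycle addn1.
Qed.

Lemma c4_label_opposite (t : nat) (x : 'I_4) (j : 'I_t) :
  c4_label t (Some (ordS x, j)) + c4_label t (Some (ord_pred x, j)) = 4 * t + 1.
Proof.
have := ltn_ord j; case: x => [[|[|[|[|]]]] hx] //=; lia.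
Qed.

(** Counts the blocks of weight [4t+1] in a neighbourhood: one for [u] at the top level, and one
    opposite pair for each adjacent level. *)
Lemma card_level_adj (t : nat) (i : 'I_t) : 2 <= t ->
  (i == t.-1 :> nat) + #|[pred j : 'I_t | level_adj i j]| = 2.
Proof.
move=> ht; have hi := ltn_ord i.
(* Truncated predecessor makes [i.-1] adjacent to [i] in all cases: for [i = 0] it is the loop. *)
have hp : i.-1 < t by lia.
rewrite (cardD1 (Ordinal hp)) inE {1}/level_adj /=.
have -> : [|| (i == 0 :> nat) && (i.-1 == 0), i.-1 == i.+1
            | i == i.-1.+1 :> nat] by lia.
have [hl|hl] := eqVneq (nat_of_ord i) t.-1.
  rewrite eq_card0 // => j; rewrite !inE -val_eqE /level_adj /=.
  by have := ltn_ord j; lia.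
have hs : i.+1 < t by lia.
rewrite (eq_card1 (x := Ordinal hs)) // => j.
rewrite !inE -!val_eqE /level_adj /=.
by have := ltn_ord j; lia.
Qed.

Lemma distance_magic_mycielskian_c4 (t : nat) :
  2 <= t -> distance_magic (mycielskian t (cycle_graph 4)).
Proof.
move=> ht; exists (@c4_label t), (2 * (4 * t + 1)); split.
- exact: c4_label_inj.
- by move=> m; rewrite c4_label_codom card_mycielskian_cycle addn1.
case=> [[x i]|].
  (* The factor 2 of the magic constant is expanded into the block count, so that the two sides
     match block by block. *)
  rewrite sum_mycielskian_nbhd // -[X in X * _](card_level_adj t i ht) mulnDl.
  congr (_ + _); first by case: eqP; rewrite ?mul1n.
  rewrite -sum_nat_const; apply: eq_bigr => j _; exact: c4_label_opposite.
rewrite [LHS](eq_bigl (mycielskian_edge (G := cycle_graph 4) None));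
  last by move=> w; rewrite inE.
rewrite big_option /= add0n.
have h1 : t.-1 < t by lia.
(* The neighbours of [u] are the four top-level vertices, which form two opposite pairs. *)
transitivity (\sum_(x < 4) c4_label t (Some (x, Ordinal h1))).
  transitivity (\sum_(x < 4) \sum_(j < t | j == t.-1 :> nat)
                  c4_label t (Some (x, j))).
    by rewrite pair_big_dep; apply: eq_big => [[x j]|[x j] _].
  by apply: eq_bigr => x _; rewrite (big_pred1 (Ordinal h1)).
rewrite !big_ord_recl big_ord0 /=; lia.
Qed.

Theorem theorem2p8 (t n : nat) (ht : 3 <= t) (hn : 3 <= n) :
  distance_magic (mycielskian t (cycle_graph n)) <-> n = 4.
Proof.
split=> [|->]; first exact: distance_magic_mycielskian_cycle_eq4 (ltnW ht) hn.
exact: distance_magic_mycielskian_c4 (ltnW ht).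
Qed.
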